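(* Let $S\subset k^3$ be a rational ruled surface. Then there exists a standardized ruled surface parametrization $\mathcal{P}$ of $S$ such that $S\smallsetminus \mathrm{Image}(\mathcal{P})$ is contained in a line.
   Context: $k$ is an algebraically closed field of characteristic zero. A surface is an irreducible Zariski-closed subset of $k^3$ of dimension 2. A rational ruled surface is a surface $S\subset k^3$ that admits a rational parametrization (dominant rational map $k^2\dashrightarrow S$) of the form $(s,t)\mapsto\left(\frac{\alpha_i(s)+t\beta_i(s)}{\gamma(s)}\right)_{i=1,2,3}$ with $\alpha_i,\beta_i,\gamma\in k[s]$, $\gamma\neq 0$. A standardized ruled surface parametrization of a ruled surface $S$ is a triple of rational functions that determines a dominant rational map $$\mathcal{P}:k^2\dashrightarrow S,\quad (s,t)\mapsto\left(\frac{r_1(s)+t\,p_1(s)}{q(s)},\frac{r_2(s)+t\,p_2(s)}{q(s)},\frac{r_3(s)+t\,p_3(s)}{q(s)}\right)$$ with $r_i,p_i,q\in k[s]$, $q\ne 0$, such that those $p_i$ that are nonzero have the same degree and do not have any common root (not all three $p_i$ are zero; if only one is nonzero, it is a nonzero constant). $\mathrm{Image}(\mathcal{P})$ is the set of values $\mathcal{P}(s_0,t_0)$ with $(s_0,t_0)\in k^2$, $q(s_0)\neq 0$. *)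

(* Defs.v *)
From HB Require Import structures.
From mathcomp Require Import all_boot all_order all_algebra.
From mathcomp Require Import mpoly.

Set Implicit Arguments.
Unset Strict Implicit.
Unset Printing Implicit Defensive.

Import GRing.Theory.
Local Open Scope ring_scope.

Section Zariski.
Variables (k : fieldType) (n : nat).
Implicit Types A B C S : 'rV[k]_n -> Prop.

Definition subset A B := forall x, A x -> B x.

Definition proper_subset A B := subset A B /\ ~ subset B A.

Definition zariski_closed A :=
  exists F : {mpoly k[n]} -> Prop,
    forall x, A x <-> (forall f, F f -> f.@[x ord0] = 0).

Definition zariski_closure A : 'rV[k]_n -> Prop :=
  fun x => forall C, zariski_closed C -> subset A C -> C x.

Definition irreducible A :=
  (exists x, A x) /\
  (forall B C, zariski_closed B -> zariski_closed C ->
     subset A (fun x => B x \/ C x) -> subset A B \/ subset A C).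

(* There is a strictly increasing chain Z 0, ..., Z d of irreducible closed
   subsets of the closed set A; the values Z i for i > d are irrelevant. *)
Definition irreducible_chain A (d : nat) :=
  exists Z : nat -> 'rV[k]_n -> Prop,
    (forall i, (i <= d)%N ->
       [/\ zariski_closed (Z i), irreducible (Z i) & subset (Z i) A]) /\
    (forall i, (i < d)%N -> proper_subset (Z i) (Z i.+1)).

(* Krull dimension, for a Zariski-closed A. *)
Definition has_dimension A (d : nat) :=
  irreducible_chain A d /\
  (forall e, irreducible_chain A e -> (e <= d)%N).

(* A is the set of values of a rational map; the map is dominant onto S. *)
Definition dominates A S := subset A S /\ subset S (zariski_closure A).

Definition is_line A :=
  exists a v : 'rV[k]_n, v != 0 /\ (forall x, A x <-> exists u, x = a + u *: v).

End Zariski.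

Section Ruled.
Variable k : fieldType.
Implicit Types (S : 'rV[k]_3 -> Prop) (r p : 'I_3 -> {poly k}) (q : {poly k}).

Definition is_surface S :=
  [/\ zariski_closed S, irreducible S & has_dimension S 2].

Definition ruled_map r p q (s t : k) : 'rV[k]_3 :=
  \row_i (((r i).[s] + t * (p i).[s]) / q.[s]).

Definition ruled_image r p q : 'rV[k]_3 -> Prop :=
  fun x => exists s t, q.[s] != 0 /\ x = ruled_map r p q s t.

Definition rational_ruled_surface S :=
  is_surface S /\
  (exists (alpha beta : 'I_3 -> {poly k}) (gamma : {poly k}),
     gamma != 0 /\ dominates (ruled_image alpha beta gamma) S).

(* The last clause excludes a root common to all the nonzero p i; over an
   algebraically closed field it forces p i to be a nonzero constant when it
   is the only nonzero one. *)
Definition standardized_parametrization S r p q :=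
  [/\ q != 0,
      dominates (ruled_image r p q) S,
      exists i, p i != 0,
      forall i j, p i != 0 -> p j != 0 -> size (p i) = size (p j)
    & ~ exists s, forall i, p i != 0 -> root (p i) s].

End Ruled.

(* Main.v *)
(* Write the ruling as (alpha + t beta) / gamma. The direction beta is nonzero,
   since otherwise S would be the closure of a curve. Sending a generic
   parameter value to infinity makes the nonzero beta_i of equal degree;
   dividing by their gcd gives p. Dividing the Pluecker coordinates
   (gamma p, alpha x p) of the line of parameter s by the gcd of gamma and
   alpha x p, Bezout yields q and a polynomial r with the same lines (r + t p) / q
   and with q and r x p coprime. A point x of S satisfies
   q(s) (x x p(s)) = (r x p)(s) for some s in P^1, by elimination of s. A finite
   s must have q(s) <> 0 by coprimality, so x lies in the image; hence all
   missing points lie on the line of parameter s = oo. Cross products are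
   written through their entries a_i b_j - a_j b_i. *)

Require Import Defs.
From HB Require Import structures.
From mathcomp Require Import all_boot all_order all_algebra.
From mathcomp Require Import mpoly ring.

Set Implicit Arguments.
Unset Strict Implicit.
Unset Printing Implicit Defensive.

Import GRing.Theory.
Local Open Scope ring_scope.

(** * Polynomial tools: Bezout identities, denominators, generic combinations, resultants *)

(** A gcd [g] is built as a linear combination by adding one entry at a time; dividing by [g] leaves
    a Bezout identity for the cofactors [w]. *)
Lemma bezout_family (k : fieldType) (I : finType) (v : I -> {poly k}) :
  (exists i, v i != 0) ->
  exists (g : {poly k}) (w c : I -> {poly k}),
    [/\ g != 0, forall i, v i = g * w i & \sum_i c i * w i = 1].
Proof.
move=> [i0 vi0].
have /(_ (enum I) (enum_uniq _)) [c dvg] : forall e : seq I, uniq e ->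
    exists c : I -> {poly k},
      forall i, i \in e -> \sum_(j <- e) c j * v j %| v i.
  elim=> [|a e IHe] /=; first by exists (fun=> 0).
  case/andP=> ae /IHe [c dvc]; set g := \sum_(j <- e) _ in dvc.
  have [[u1 u2] /= hu] := Bezoutp (v a) g.
  exists (fun i => if i == a then u1 else u2 * c i).
  suff -> : \sum_(j <- a :: e) (if j == a then u1 else u2 * c j) * v j
      = u1 * v a + u2 * g.
    move=> i; rewrite inE => /predU1P [->|ie].
      by rewrite (eqp_dvdl _ hu) dvdp_gcdl.
    by rewrite (eqp_dvdl _ hu) (dvdp_trans (dvdp_gcdr _ _)) ?dvc.
  rewrite big_cons eqxx; congr (_ + _); rewrite mulr_sumr.
  apply: eq_big_seq => j je; rewrite ifN ?mulrA //.
  by apply: contraNneq ae => <-.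
set g := \sum_(j <- _) _ in dvg.
have{} dvg i : g %| v i by rewrite dvg ?mem_enum.
have g0 : g != 0 by apply: contraNneq vi0 => g0; rewrite -dvd0p -g0.
exists g, (fun i => v i %/ g), c; split=> // [i|].
  by rewrite mulrC divpK.
apply: (mulIf g0); rewrite mul1r mulr_suml.
transitivity (\sum_i c i * v i); last by rewrite /g big_enum.
by apply: eq_bigr => i _; rewrite -mulrA divpK.
Qed.

(** Fractions over powers of [q] are stable under sums and products. An equation restricted to a
    rational curve thus becomes one polynomial [G] in the parameter. *)
Lemma meval_fractions (k : fieldType) n (A : 'I_n -> {poly k}) (q : {poly k})
    (f : {mpoly k[n]}) :
  exists (G : {poly k}) d, forall s, q.[s] != 0 ->
    f.@[fun i => (A i).[s] / q.[s]] * q.[s] ^+ d = G.[s].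
Proof.
pose regular (f : {mpoly k[n]}) :=
  exists (G : {poly k}) d, forall s, q.[s] != 0 ->
    f.@[fun i => (A i).[s] / q.[s]] * q.[s] ^+ d = G.[s].
have regC c : regular c%:MP.
  by exists c%:P, 0%N => s _; rewrite mevalC expr0 mulr1 hornerC.
have regM f1 f2 : regular f1 -> regular f2 -> regular (f1 * f2).
  move=> [G1 [d1 h1]] [G2 [d2 h2]]; exists (G1 * G2), (d1 + d2)%N => s qs.
  by rewrite hornerM -h1 // -h2 // mevalM exprD mulrACA.
have regD f1 f2 : regular f1 -> regular f2 -> regular (f1 + f2).
  move=> [G1 [d1 h1]] [G2 [d2 h2]].
  exists (G1 * q ^+ d2 + G2 * q ^+ d1), (d1 + d2)%N => s qs.
  rewrite !hornerE -h1 // -h2 // mevalD exprD; ring.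
have regX i : regular 'X_i.
  by exists (A i), 1%N => s qs; rewrite mevalXU expr1 divfK.
change (regular f); have reg0 : regular 0 by rewrite -mpolyC0.
rewrite (mpolyE f); apply: big_ind => // m _; rewrite -mul_mpolyC mpolyXE_id; apply: (regM) => //.
have reg1 : regular 1 by rewrite -mpolyC1.
apply: big_ind => // i _; elim: (m i) => [|e IHe] //.
by rewrite exprS; apply: regM.
Qed.

(** The coefficients are powers of a single [c]: each vector [u t] becomes a nonzero polynomial, and
    [c] avoids the roots of their product. *)
Lemma generic_combination (k : closedFieldType) (I : finType) (T : eqType)
    (s : seq T) (u : T -> I -> k) :
  (forall t, t \in s -> exists i, u t i != 0) ->
  exists a : I -> k, forall t, t \in s -> \sum_i a i * u t i != 0.
Proof.
pose P t := \sum_i u t i *: 'X^(enum_rank i).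
move=> u0; have : \prod_(t <- s) P t != 0.
  rewrite prodf_seq_neq0; apply/allP => t /u0 [i ui] /=.
  apply: contraNneq ui => /(congr1 (fun p : {poly k} => p`_(enum_rank i))).
  rewrite coef0 coef_sum (bigD1 i) //= coefZ coefXn eqxx mulr1 big1 ?addr0.
    by move=> ->.
  move=> j ji; rewrite coefZ coefXn; case: eqP => [/ord_inj/enum_rank_inj eij|].
    by rewrite eij eqxx in ji.
  by rewrite mulr0.
move=> /closed_nonrootP [c]; rewrite rootE horner_prod prodf_seq_neq0.
move=> /allP hc; exists (fun i => c ^+ enum_rank i) => t /hc /=.
rewrite horner_sum; congr (_ != 0); apply: eq_bigr => i _.
by rewrite !hornerE mulrC.
Qed.

(* mxpoly's map_resultant only covers morphisms whose domain is a univariate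
   polynomial ring. *)
Lemma rmorph_resultant (A B : nzRingType) (f : {rmorphism A -> B})
    (p q : {poly A}) :
  f (lead_coef p) != 0 -> f (lead_coef q) != 0 ->
  f (resultant p q) = resultant (map_poly f p) (map_poly f q).
Proof.
move=> fp fq; rewrite /resultant /Sylvester_mx !size_map_poly_id0 //.
rewrite -det_map_mx; congr (\det _); apply/matrixP => i j.
rewrite !mxE; case: split => l; rewrite !mxE /= !rVpoly_delta !coefXnM coef_map.
  by case: ifP; rewrite ?rmorph0.
by case: ifP; rewrite ?rmorph0.
Qed.

(** * Zariski closure and elimination of one parameter *)

Lemma hypersurface_closed (k : fieldType) n (f : {mpoly k[n]}) :
  zariski_closed (fun x => f.@[x ord0] = 0).
Proof. by exists (eq f) => y; split=> [fy _ <-|/(_ f erefl)]. Qed.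

Lemma closure_meval0 (k : fieldType) n (A : 'rV[k]_n -> Prop) (f : {mpoly k[n]}) :
  (forall x, A x -> f.@[x ord0] = 0) ->
  forall x, zariski_closure A x -> f.@[x ord0] = 0.
Proof.
by move=> Af x /(_ _ (hypersurface_closed f)); apply.
Qed.

Section Elimination.
Variables (k : closedFieldType) (n : nat) (I : finType).
Variables (F : I -> {poly {mpoly k[n]}}) (N : nat).
Hypothesis sizeF : forall i, (size (F i) <= N.+1)%N.

Let evp (x : 'rV[k]_n) : {poly {mpoly k[n]}} -> {poly k} :=
  map_poly (meval (x ord0)).

Let comb (a : I -> k) := \sum_i (a i)%:MP *: F i.

Let size_comb a : (size (comb a) <= N.+1)%N.
Proof.
apply: (leq_trans (size_sum _ _ _)); apply/bigmax_leqP => i _.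
exact: leq_trans (size_scale_leq _ _) (sizeF i).
Qed.

Let evp_comb x a : evp x (comb a) = \sum_i a i *: evp x (F i).
Proof.
rewrite /evp /comb rmorph_sum; apply: eq_bigr => i _ /=.
by rewrite map_polyZ /= mevalC.
Qed.

Let coef_evp x P j : (evp x P)`_j = (P`_j).@[x ord0].
Proof. by rewrite /evp coef_map. Qed.

(** The degree [N] is attained before and after evaluation, so that evaluation at [x] commutes with
    the resultant. *)
Let size_evp_comb x a : (evp x (comb a))`_N != 0 ->
  size (comb a) = N.+1 /\ size (evp x (comb a)) = N.+1.
Proof.
move=> c0; have h1 : (N < size (evp x (comb a)))%N.
  by rewrite ltnNge; apply: contra c0 => /leq_sizeP ->.
have h2 := leq_trans h1 (size_poly _ _).
have e : size (comb a) = N.+1 by apply/eqP; rewrite eqn_leq size_comb h2.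
split=> //; apply/eqP; rewrite eqn_leq h1 andbT -e; exact: size_poly.
Qed.

(* This is the properness of the projection from [P^1 x A^n]: the second
   alternative is a common root at [s = oo] in formal degree [N]. Resultants of
   pairs of generic combinations of the [F i] suffice to detect it. *)
Lemma elimination x :
  zariski_closure (fun y => exists s, forall i, root (evp y (F i)) s) x ->
  (exists s, forall i, root (evp x (F i)) s) \/
  (forall i, (evp x (F i))`_N = 0).
Proof.
move=> clx.
case: (boolP [forall i, (evp x (F i))`_N == 0]) => [/forallP h|].
  by right=> i; apply/eqP.
rewrite negb_forall => /existsP [i0 Fi0]; left.
(* [None] stands for [s = oo], where the value is the coefficient of index [N]. *)
pose u (o : option k) i :=
  if o is Some s then (evp x (F i)).[s] else (evp x (F i))`_N.
have uN a : \sum_i a i * u None i = (evp x (comb a))`_N.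
  by rewrite evp_comb coef_sum; apply: eq_bigr => i _; rewrite coefZ.
have uS a s : \sum_i a i * u (Some s) i = (evp x (comb a)).[s].
  by rewrite evp_comb horner_sum; apply: eq_bigr => i _; rewrite hornerZ.
have [|a] := @generic_combination k I _ [:: None] u.
  by move=> t; rewrite inE => /eqP ->; exists i0.
move/(_ None (mem_head _ _)); rewrite uN => aN.
have [sa sxa] := size_evp_comb aN.
have [rs ers] := closed_field_poly_normal (evp x (comb a)).
have rootsE s : root (evp x (comb a)) s = (s \in rs).
  by rewrite ers rootZ ?root_prod_XsubC // lead_coef_eq0 -size_poly_eq0 sxa.
case: (boolP (has (fun s => [forall i, root (evp x (F i)) s]) rs)).
  by case/hasP => s _ /forallP h; exists s.
rewrite -all_predC => /allP hrs.
(* The second combination is nonzero at [oo] and at each root of the first; it exists because no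
   element of [rs] is a common root of all the [F i] at [x]. *)
have [|b hb] := @generic_combination k I _ (None :: map Some rs) u.
  move=> t; rewrite inE => /predU1P [->|/mapP [s /hrs /= hs ->]].
    by exists i0.
  by move: hs; rewrite negb_forall => /existsP [i hi]; exists i.
have bN := hb _ (mem_head _ _); rewrite uN in bN.
have [sb sxb] := size_evp_comb bN.
have cop : coprimep (evp x (comb a)) (evp x (comb b)).
  apply/Pdiv.ClosedField.coprimepP => s; rewrite rootsE -uS => hs.
  by apply: hb; rewrite inE map_f ?orbT.
(* The resultant is known to lie in the ideal only in positive degree. For [N = 0] the single
   coefficient of [F i0] vanishes on the closure. *)
case: (posnP N) => [N0|Npos].
  have Fconst : F i0 = ((F i0)`_N)%:P.
    by rewrite N0; apply: size1_polyC; rewrite -[X in X.+1]N0.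
  case/eqP: Fi0; rewrite coef_evp.
  apply: closure_meval0 clx => y [s /(_ i0)].
  by rewrite /evp [X in map_poly _ X]Fconst map_polyC rootE hornerC => /eqP.
(* Being in the ideal of the two combinations, the resultant vanishes wherever there is a common
   root, hence also at [x], against coprimality there. *)
have : (resultant (comb a) (comb b)).@[x ord0] = 0.
  apply: closure_meval0 clx => y [s hs].
  have [||[U V] /= _ /(congr1 (fun P => (evp y P).[s]))] :=
    @resultant_in_ideal _ (comb a) (comb b); rewrite ?sa ?sb //.
  have root_comb c : (evp y (comb c)).[s] = 0.
    rewrite evp_comb horner_sum big1 // => i _; rewrite hornerZ.
    by rewrite (rootP (hs i)) mulr0.
  have evpM P Q : evp y (P * Q) = evp y P * evp y Q by apply: rmorphM.
  have -> : evp y (U * comb a + V * comb b)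
      = evp y (U * comb a) + evp y (V * comb b) by apply: rmorphD.
  rewrite !evpM hornerD !hornerM !root_comb !mulr0 addr0.
  by rewrite /evp map_polyC hornerC.
have lead c : size (comb c) = N.+1 -> (evp x (comb c))`_N != 0 ->
    (lead_coef (comb c)).@[x ord0] != 0.
  by move=> e; rewrite lead_coefE e coef_evp.
rewrite rmorph_resultant ?lead // => /eqP; rewrite resultant_eq0.
by move: cop; rewrite /coprimep => /eqP ->.
Qed.

End Elimination.

(** * Changing the parametrization of a ruled image *)

(** For fixed [t], an equation of [C] pulls back to a polynomial in [s] over a power of [q]. It
    vanishes off the roots of [q * h], hence identically since [k] is infinite. *)
Lemma ruled_image_subset_closed (k : closedFieldType)
    (r p : 'I_3 -> {poly k}) (q h : {poly k}) (C : 'rV[k]_3 -> Prop) :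
  zariski_closed C -> q != 0 -> h != 0 ->
  (forall s t, q.[s] != 0 -> h.[s] != 0 -> C (ruled_map r p q s t)) ->
  Defs.subset (ruled_image r p q) C.
Proof.
move=> [F CF] q0 h0 hC x [s [t [qs ->]]]; apply/CF => f Ff.
have [G [d hG]] := meval_fractions (fun i => r i + t *: p i) q f.
have evE s' : f.@[ruled_map r p q s' t ord0]
    = f.@[fun i => (r i + t *: p i).[s'] / q.[s']].
  by apply: meval_eq => i; rewrite mxE !hornerE.
have : G * (q * h) = 0.
  apply/eqP/negbNE/negP => /closed_nonrootP [c].
  rewrite !rootM !negb_or => /and3P [Gc qc hc]; case/negP: Gc.
  by rewrite rootE -hG // -evE (proj1 (CF _) (hC c t qc hc)) // mul0r.
move/eqP; rewrite mulf_eq0 (negbTE (mulf_neq0 q0 h0)) orbF => /eqP G0.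
have /eqP := hG s qs; rewrite G0 horner0 mulf_eq0 (negbTE (expf_neq0 d qs)) orbF.
by rewrite evE => /eqP.
Qed.

(** Closed sets do not detect the finitely many rulings over the roots of [h] and [h']. *)
Lemma dominates_reparametrized (k : closedFieldType) (S : 'rV[k]_3 -> Prop)
    (r p r' p' : 'I_3 -> {poly k}) (q q' h h' : {poly k}) :
  zariski_closed S -> q != 0 -> q' != 0 -> h != 0 -> h' != 0 ->
  (forall s t, q.[s] != 0 -> h.[s] != 0 ->
     ruled_image r' p' q' (ruled_map r p q s t)) ->
  (forall s t, q'.[s] != 0 -> h'.[s] != 0 ->
     ruled_image r p q (ruled_map r' p' q' s t)) ->
  dominates (ruled_image r p q) S -> dominates (ruled_image r' p' q') S.
Proof.
move=> Scl q0 q'0 h0 h'0 hto hfrom [sub dom]; split.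
  by apply: (ruled_image_subset_closed Scl q'0 h'0) => s t qs hs; apply/sub/hfrom.
move=> x /dom clx C Ccl hC; apply: clx => //.
by apply: (ruled_image_subset_closed Ccl q0 h0) => s t qs hs; apply/hC/hto.
Qed.

(** * Dimension of the closure of a rational curve *)

(** [N] serves as formal degree in the eliminations; the nonzero coefficient keeps the condition at
    [s = oo] nontrivial. *)
Lemma max_degree_coef (k : fieldType) (I : finType) (w : I -> {poly k}) :
  (exists i, w i != 0) ->
  exists N, (forall i, (size (w i) <= N.+1)%N) /\ exists i, (w i)`_N != 0.
Proof.
move=> [i0 wi0]; case: (arg_maxnP (fun i => size (w i)) (isT : xpredT i0)).
move=> i _ hi; have szi : (0 < size (w i))%N.
  by rewrite (leq_trans _ (hi i0 isT)) // lt0n size_poly_eq0.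
exists (size (w i)).-1; rewrite prednK //; split=> [j|]; first exact: hi.
by exists i; rewrite -lead_coefE lead_coef_eq0 -size_poly_gt0.
Qed.

(** Each step covers [A] by the hyperplane of value [b] and the zero set of the product over the
    remaining values; irreducibility selects one of them. *)
Lemma irreducible_coord (k : fieldType) n (A : 'rV[k]_n -> Prop) i (L : seq k) :
  irreducible A -> (forall x, A x -> x ord0 i \in L) ->
  exists a, forall x, A x -> x ord0 i = a.
Proof.
move=> [[x0 Ax0] irr]; elim: L => [/(_ _ Ax0)|b L IH hL]; first by rewrite in_nil.
pose f := \prod_(a <- L) ('X_i - a%:MP) : {mpoly k[n]}.
have evX a (x : 'rV[k]_n) : ('X_i - a%:MP).@[x ord0] = x ord0 i - a.
  by rewrite mevalB mevalXU mevalC.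
have evf (x : 'rV[k]_n) : (f.@[x ord0] == 0) = (x ord0 i \in L).
  rewrite (big_morph _ (mevalM _) (meval1 _)) prodf_seq_eq0 -has_pred1; apply: eq_has => a /=.
  by rewrite evX subr_eq0 eq_sym.
have [|hb|hf] := irr _ _ (hypersurface_closed ('X_i - b%:MP)) (hypersurface_closed f).
- move=> x /hL; rewrite inE evX => /predU1P [->|]; first by left; rewrite subrr.
  by rewrite -evf => /eqP; right.
- by exists b => x /hb; rewrite evX => /eqP; rewrite subr_eq0 => /eqP.
by apply: IH => x /hf /eqP; rewrite evf.
Qed.

Lemma map_mpolyC_meval (k : fieldType) n (v : 'I_n -> k) (p : {poly k}) :
  map_poly (meval v) (map_poly (@mpolyC n k) p) = p.
Proof.
rewrite -map_poly_comp map_poly_id // => c _ /=; exact: mevalC.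
Qed.

Definition curve_image (k : fieldType) n (a : 'I_n -> {poly k}) (q : {poly k}) :
    'rV[k]_n -> Prop :=
  fun x => exists s, q.[s] != 0 /\ x = \row_i ((a i).[s] / q.[s]).

(* A curve with coprime data misses at most the one point [s = oo] of its
   closure, so its proper closed subsets are finite. *)
Lemma curve_closure_dim (k : closedFieldType) n (S : 'rV[k]_n -> Prop)
    (alpha : 'I_n -> {poly k}) (gamma : {poly k}) :
  gamma != 0 -> Defs.subset S (zariski_closure (curve_image alpha gamma)) ->
  ~ irreducible_chain S 2.
Proof.
move=> gamma0 Scl [Z [hZ hlt]].
pose v o := if o is Some i then alpha i else gamma.
have [|g [w [c [g0 vE bez]]]] := @bezout_family k (option 'I_n) v.
  by exists None.
pose q := w None; pose a i := w (Some i).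
have gammaE : gamma = g * q by apply: (vE None).
have alphaE i : alpha i = g * a i by apply: (vE (Some i)).
have q0 : q != 0 by apply: contraNneq gamma0; rewrite gammaE => ->; rewrite mulr0.
have curve_sub x : curve_image alpha gamma x ->
    exists s, q.[s] != 0 /\ forall i, x ord0 i = (a i).[s] / q.[s].
  move=> [s [gs ->]]; exists s; move: gs; rewrite gammaE hornerM mulf_eq0.
  rewrite negb_or => /andP [gs qs]; split=> // i.
  by rewrite mxE alphaE hornerM; field; rewrite gs qs.
have [|N [szN [oN wN]]] := @max_degree_coef k _ w; first by exists None.
pose F i : {poly {mpoly k[n]}} :=
  'X_i *: map_poly (@mpolyC n k) q - map_poly (@mpolyC n k) (a i).
have FE i (x : 'rV[k]_n) :
    map_poly (meval (x ord0)) (F i) = x ord0 i *: q - a i.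
  rewrite rmorphB /= !map_mpolyC_meval; congr (_ - _).
  by rewrite map_polyZ /= mevalXU map_mpolyC_meval.
have szF i : (size (F i) <= N.+1)%N.
  apply: (leq_trans (size_polyD _ _)); rewrite geq_max size_polyN.
  by rewrite (leq_trans (size_scale_leq _ _)) ?(leq_trans (size_poly _ _)) ?szN.
have S_pt x : S x ->
    (exists s, q.[s] != 0 /\ forall i, x ord0 i = (a i).[s] / q.[s]) \/
    (forall i, x ord0 i = (a i)`_N / q`_N).
  move=> /Scl clx; have := @elimination k n _ F N szF x; case.
  - move=> C Ccl hC; apply: clx => // y /curve_sub [s [qs hs]]; apply: hC.
    exists s => i; rewrite FE rootE !hornerE hs divfK ?subrr //.
  - move=> [s hs]; left; exists s; have wE i : x ord0 i * q.[s] = (a i).[s].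
      by have := hs i; rewrite FE rootE !hornerE subr_eq0 => /eqP.
    (* At a root of [q], [wE] would make every [w o] vanish, against the Bezout identity. *)
    have qs : q.[s] != 0.
      apply/eqP => qs; have /(congr1 (fun P : {poly k} => P.[s])) := bez.
      rewrite hornerC horner_sum big1 => [/esym/eqP|o _]; first by rewrite oner_eq0.
      rewrite hornerM; suff -> : (w o).[s] = 0 by rewrite mulr0.
      by case: o => [i|//]; rewrite -/(a i) -wE qs mulr0.
    by split=> // i; rewrite -wE mulfK.
  - move=> hN; right; have wE i : x ord0 i * q`_N = (a i)`_N.
      by have := hN i; rewrite FE coefB coefZ => /eqP; rewrite subr_eq0 => /eqP.
    (* If this coefficient were zero, so would be those of all [a i], against the choice of [N]. *)
    have qN : q`_N != 0.
      apply: contraNneq wN => qN; case: oN => [i|]; last exact/eqP.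
      by rewrite -/(a i) -wE qN mulr0.
    by move=> i; rewrite -wE mulfK.
have [|[F1 Z1F] irr1 Z1S] := hZ 1%N; first by [].
have [|_ [[y0 Z0y0] _] _] := hZ 0%N; first by [].
have [|_ _ Z2S] := hZ 2%N; first by [].
have [|Z01 Z10] := hlt 0%N; first by [].
have [|_ []] := hlt 1%N; first by [].
(* Suppose an equation [f] of [Z 1] fails at a point of [Z 2]. Its numerator [G] along the curve is
   then nonzero, so each coordinate takes finitely many values on [Z 1]. By irreducibility [Z 1] is
   one point and cannot properly contain [Z 0]. *)
move=> y Z2y; apply/Z1F => f F1f; apply/eqP/negbNE/negP => fy.
have [G [d hG]] := meval_fractions a q f.
have G0 : G != 0.
  apply: contraNneq fy => G0; apply/eqP; apply: closure_meval0 (Scl _ (Z2S _ Z2y)).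
  move=> x /curve_sub [s [qs hs]]; rewrite (meval_eq f hs).
  apply: (mulIf (expf_neq0 d qs)); rewrite hG //.
  by rewrite G0 horner0 mul0r.
have [rs ers] := closed_field_poly_normal G.
have irr_pt i : exists b, forall x, Z 1%N x -> x ord0 i = b.
  apply: (irreducible_coord (L := (a i)`_N / q`_N ::
            map (fun s => (a i).[s] / q.[s]) rs) irr1).
  move=> x Z1x; rewrite inE; case: (S_pt x (Z1S x Z1x)) => [[s [qs hs]]|->].
    apply/orP; right; apply/mapP; exists s; last exact: hs.
    rewrite -root_prod_XsubC.
    have : root G s.
      by rewrite rootE -hG // -(meval_eq f hs) (proj1 (Z1F x) Z1x) ?mul0r.
    by rewrite ers rootZ // lead_coef_eq0.
  by rewrite eqxx.
case: Z10 => x Z1x; suff -> : x = y0 by [].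
apply/rowP => i; have [b hb] := irr_pt i.
by rewrite (hb _ Z1x) (hb _ (Z01 _ Z0y0)).
Qed.

(** * Equalizing the degrees of the direction *)

Section Inversion.
Variables (k : fieldType) (N : nat) (s0 : k).
Implicit Types p : {poly k}.

(* The numerator [s^N p(s0 + 1/s)] of the change of parameter [s0 + 1/s]. *)
Definition inversion p : {poly k} :=
  \poly_(i < N.+1) (p \Po ('X + s0%:P))`_(N - i).

Lemma horner_inversion p s : (size p <= N.+1)%N -> s != 0 ->
  (inversion p).[s] = s ^+ N * p.[s0 + s^-1].
Proof.
move=> szp s0'; have szc : (size (p \Po ('X + s0%:P)) <= N.+1)%N.
  by rewrite -(opprK s0%:P) -polyCN size_comp_poly2 ?size_XsubC.
have -> : p.[s0 + s^-1] = (p \Po ('X + s0%:P)).[s^-1].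
  by rewrite horner_comp !hornerE addrC.
rewrite horner_poly (horner_coef_wide _ szc) mulr_sumr (reindex_inj rev_ord_inj).
apply: eq_bigr => i _ /=; rewrite subSS subKn -1?ltnS // mulrCA; congr (_ * _).
have iN : (i <= N)%N by rewrite -ltnS.
apply: (mulIf (expf_neq0 i s0')); rewrite -exprD subnK // exprVn divfK //.
by rewrite expf_neq0.
Qed.

(** The constant term [p.[s0]] of the shifted polynomial becomes the coefficient of index [N]. *)
Lemma size_inversion p : p.[s0] != 0 -> size (inversion p) = N.+1.
Proof.
move=> ps; apply: size_poly_eq; rewrite /= subnn -horner_coef0 horner_comp.
by rewrite !hornerE.
Qed.

Lemma inversion0 : inversion 0 = 0.
Proof. by apply/polyP => i; rewrite coef_poly comp_poly0 !coef0 if_same. Qed.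

End Inversion.

Lemma equal_degree_directions (k : closedFieldType) (S : 'rV[k]_3 -> Prop)
    (alpha beta : 'I_3 -> {poly k}) (gamma : {poly k}) :
  zariski_closed S -> gamma != 0 -> (exists i, beta i != 0) ->
  dominates (ruled_image alpha beta gamma) S ->
  exists (alpha' beta' : 'I_3 -> {poly k}) (gamma' : {poly k}),
    [/\ gamma' != 0, exists i, beta' i != 0,
        forall i j, beta' i != 0 -> beta' j != 0 -> size (beta' i) = size (beta' j)
      & dominates (ruled_image alpha' beta' gamma') S].
Proof.
move=> Scl gamma0 [i0 bi0] dom.
have [s0 hs0] : exists s0, forall i, beta i != 0 -> (beta i).[s0] != 0.
  have : \prod_(i | beta i != 0) beta i != 0 by apply/prodf_neq0.
  move=> /closed_nonrootP [s0]; rewrite rootE horner_prod => /prodf_neq0 h.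
  by exists s0 => i /h.
(* One exponent bounds all degrees, so the factors [s ^+ N] cancel in every quotient. *)
pose N := (size gamma + \sum_i (size (alpha i) + size (beta i)))%N.
have szg : (size gamma <= N.+1)%N by rewrite leqW // leq_addr.
have szab i : (size (alpha i) <= N.+1)%N /\ (size (beta i) <= N.+1)%N.
  have : (size (alpha i) + size (beta i) <= N)%N.
    by rewrite /N (bigD1 i) //= addnCA leq_addr.
  by move=> le; split; apply/leqW/(leq_trans _ le); rewrite (leq_addl, leq_addr).
pose inv := inversion N s0.
have invE s t : s != 0 -> gamma.[s0 + s^-1] != 0 ->
    ruled_map (fun i => inv (alpha i)) (fun i => inv (beta i)) (inv gamma) s t
    = ruled_map alpha beta gamma (s0 + s^-1) t.
  move=> ns gs; apply/rowP => i; have [sza szb] := szab i.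
  rewrite !mxE /inv !horner_inversion //; field.
  by rewrite gs expf_neq0.
have inv_gamma s : s != 0 ->
    ((inv gamma).[s] != 0) = (gamma.[s0 + s^-1] != 0).
  by move=> ns; rewrite horner_inversion // mulf_eq0 expf_eq0 (negbTE ns) andbF.
have Xs0 : 'X - s0%:P != 0 by rewrite polyXsubC_eq0.
have inv_s0 c : ('X - s0%:P).[c] != 0 ->
    (c - s0)^-1 != 0 /\ s0 + (c - s0)^-1^-1 = c.
  by rewrite hornerXsubC invr_eq0 invrK [s0 + _]addrC subrK.
have g'0 : inv gamma != 0.
  have /closed_nonrootP [c] : gamma * ('X - s0%:P) != 0 by rewrite mulf_neq0.
  rewrite rootM negb_or => /andP [gc /inv_s0 [nc cE]].
  apply: contraNneq gc => e; move: (inv_gamma _ nc).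
  by rewrite e horner0 eqxx cE rootE => /esym/negbFE.
have invb0 i : inv (beta i) != 0 -> beta i != 0.
  by apply: contraNneq => ->; rewrite /inv inversion0.
have szb i : inv (beta i) != 0 -> size (inv (beta i)) = N.+1.
  by move=> /invb0/hs0; apply: size_inversion.
exists (fun i => inv (alpha i)), (fun i => inv (beta i)), (inv gamma); split=> //.
- by exists i0; rewrite -size_poly_eq0 size_inversion ?hs0.
- by move=> i j bi bj; rewrite !szb.
(* The excluded parameters are [s0], sent to infinity, and [0], which comes from infinity. *)
apply: (dominates_reparametrized Scl gamma0 g'0 Xs0 (negbT (polyX_eq0 k))) dom.
  move=> c t gc /inv_s0 [nc cE]; exists (c - s0)^-1, t.
  by rewrite inv_gamma // invE // cE.
move=> s t; rewrite hornerX => gs ns; exists (s0 + s^-1), t.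
by rewrite invE -?inv_gamma.
Qed.

(** * Coprime Pluecker coordinates and the line at [s = oo] *)

Lemma coprime_pluecker_parametrization (k : closedFieldType)
    (S : 'rV[k]_3 -> Prop) (alpha beta : 'I_3 -> {poly k}) (gamma : {poly k}) :
  zariski_closed S -> gamma != 0 -> (exists i, beta i != 0) ->
  dominates (ruled_image alpha beta gamma) S ->
  exists (g : {poly k}) (r p : 'I_3 -> {poly k}) (q : {poly k}),
    [/\ g != 0 /\ (forall i, beta i = g * p i), q != 0,
        forall s, exists i, (p i).[s] != 0,
        forall s, q.[s] = 0 -> exists i j, (r i * p j - r j * p i).[s] != 0
      & dominates (ruled_image r p q) S].
Proof.
move=> Scl gamma0 beta0 dom.
have [g [p [c [g0 betaE cp]]]] := bezout_family beta0.
pose v o := if o is Some ij then alpha ij.1 * p ij.2 - alpha ij.2 * p ij.1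
  else gamma.
have [|h [w [c' [h0 vE cw]]]] := @bezout_family k (option ('I_3 * 'I_3)) v.
  by exists None.
pose q := w None; pose m i j := w (Some (i, j)).
have gammaE : gamma = h * q by apply: (vE None).
have mE i j : h * m i j = alpha i * p j - alpha j * p i.
  by rewrite -(vE (Some (i, j))).
(* Contracting [m] with the Bezout coefficients of [p] recovers a point of the line: [h * r i] is
   [alpha i] minus [e] times [p i], and the cross product of [r] and [p] is exactly [m]. *)
pose r i := \sum_j c j * m i j; pose e := \sum_j c j * alpha j.
have rE i : h * r i = alpha i - p i * e.
  rewrite mulr_sumr -[alpha i]mulr1 -cp !mulr_sumr -sumrB.
  by apply: eq_bigr => j _; rewrite mulrCA mE; ring.
have q0 : q != 0 by apply: contraNneq gamma0; rewrite gammaE => ->; rewrite mulr0.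
have rpE i j : r i * p j - r j * p i = m i j.
  apply: (mulfI h0); rewrite mE mulrBr !mulrA !rE; ring.
have unit_root (I : finType) (a b : I -> {poly k}) s :
    \sum_i a i * b i = 1 -> exists i, (b i).[s] != 0.
  move=> ab; apply/existsP; apply: contraT; rewrite negb_exists => /forallP b0.
  have /eqP := congr1 (fun P : {poly k} => P.[s]) ab.
  rewrite hornerC horner_sum big1 ?(eq_sym 0) ?oner_eq0 // => i _.
  by have := b0 i; rewrite negbK hornerM => /eqP ->; rewrite mulr0.
exists g, r, p, q; split=> // [s|s qs|]; first exact: unit_root cp.
  have [[[i j]|] ws] := unit_root _ _ _ s cw; last by rewrite -/q qs eqxx in ws.
  by exists i, j; rewrite rpE.
have hg0 : h * g != 0 by rewrite mulf_neq0.
have alphaE i s : (alpha i).[s] = h.[s] * (r i).[s] + (p i).[s] * e.[s].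
  by rewrite -!hornerM -hornerD rE subrK.
(* On each ruling the two forms differ by the affine change of [t] into [(e + t g) / h], invertible
   off the roots of [h * g]. *)
apply: (dominates_reparametrized Scl gamma0 q0 g0 hg0) dom => s t.
  rewrite gammaE hornerM mulf_eq0 negb_or => /andP [hs qs] gs.
  exists s, ((e.[s] + t * g.[s]) / h.[s]); split=> //; apply/rowP => i.
  by rewrite !mxE alphaE betaE !hornerM; field; rewrite hs qs.
rewrite hornerM mulf_eq0 negb_or => qs /andP [hs gs].
exists s, ((t * h.[s] - e.[s]) / g.[s]).
rewrite gammaE hornerM mulf_eq0 negb_or hs qs; split=> //; apply/rowP => i.
by rewrite !mxE alphaE betaE !hornerM; field; rewrite hs qs gs.
Qed.

Lemma missing_points_in_line (k : closedFieldType) (S : 'rV[k]_3 -> Prop)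
    (r p : 'I_3 -> {poly k}) (q : {poly k}) :
  q != 0 -> (forall s, exists i, (p i).[s] != 0) ->
  (forall s, q.[s] = 0 -> exists i j, (r i * p j - r j * p i).[s] != 0) ->
  Defs.subset S (zariski_closure (ruled_image r p q)) ->
  exists L : 'rV[k]_3 -> Prop, is_line L /\
    forall x, S x -> ~ ruled_image r p q x -> L x.
Proof.
move=> q0 p_unim coprime Scl; pose m i j := r i * p j - r j * p i.
(* These are the coefficients of the incidence equations [F], so [N] bounds the degree of [F] in
   [s]. *)
pose w (o : 'I_3 + 'I_3 * 'I_3) :=
  match o with inl i => q * p i | inr ij => m ij.1 ij.2 end.
have [|N [szN [o wN]]] := @max_degree_coef k _ w.
  have [i pi0] := p_unim 0; exists (inl i); rewrite mulf_neq0 //.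
  by apply: contraNneq pi0 => ->; rewrite horner0.
pose cst := map_poly (@mpolyC 3 k).
pose F (ij : 'I_3 * 'I_3) : {poly {mpoly k[3]}} :=
  'X_ij.1 *: cst (q * p ij.2) - 'X_ij.2 *: cst (q * p ij.1) - cst (m ij.1 ij.2).
have FE ij (x : 'rV[k]_3) : map_poly (meval (x ord0)) (F ij)
    = x ord0 ij.1 *: (q * p ij.2) - x ord0 ij.2 *: (q * p ij.1) - m ij.1 ij.2.
  by rewrite !rmorphB /= !map_polyZ /= !map_mpolyC_meval !mevalXU.
have szF ij : (size (F ij) <= N.+1)%N.
  have szC o' : (size (cst (w o')) <= N.+1)%N.
    exact: leq_trans (size_poly _ _) (szN o').
  have szZ (c : {mpoly k[3]}) o' : (size (c *: cst (w o')) <= N.+1)%N.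
    exact: leq_trans (size_scale_leq _ _) (szC o').
  have szB (P Q : {poly {mpoly k[3]}}) : (size P <= N.+1)%N ->
      (size Q <= N.+1)%N -> (size (P - Q)%R <= N.+1)%N.
    by move=> hP hQ; rewrite (leq_trans (size_polyD _ _)) // geq_max size_polyN hP.
  apply: (szB) (szC (inr ij)); apply: szB; first exact: (szZ) (inl ij.2).
  exact: szZ (inl ij.1).
have S_pt x : S x -> ruled_image r p q x \/ (forall i j,
    x ord0 i * (q * p j)`_N - x ord0 j * (q * p i)`_N = (m i j)`_N).
  move=> /Scl clx; have := @elimination k 3 _ F N szF x; case.
  - move=> C Ccl hC; apply: clx => // y [s [t [qs ->]]]; apply: hC; exists s.
    move=> ij; rewrite FE rootE !mxE !(hornerD, hornerN, hornerZ, hornerM); apply/eqP; by field.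
  - move=> [s hs]; left.
    have xE i j : q.[s] * (x ord0 i * (p j).[s] - x ord0 j * (p i).[s])
        = (r i).[s] * (p j).[s] - (r j).[s] * (p i).[s].
      have := hs (i, j); rewrite FE rootE !(hornerD, hornerN, hornerZ, hornerM) subr_eq0 => /eqP <-; ring.
    have qs : q.[s] != 0.
      apply/eqP => qs; have [i [j]] := coprime s qs.
      by rewrite !hornerE -xE qs mul0r eqxx.
    have [j pj] := p_unim s.
    (* [t] is solved from a coordinate [j] where the direction is nonzero; [xE] then gives the
       others. *)
    exists s, ((q.[s] * x ord0 j - (r j).[s]) / (p j).[s]); split=> //.
    apply/rowP => i; rewrite mxE; apply: (mulfI (mulf_neq0 qs pj)).
    transitivity (q.[s] * (x ord0 i * (p j).[s] - x ord0 j * (p i).[s])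
      + q.[s] * x ord0 j * (p i).[s]); first by ring.
    by rewrite xE; field; rewrite pj qs.
  - move=> hN; right=> i j; have := hN (i, j).
    by rewrite FE !coefB !coefZ => /eqP; rewrite subr_eq0 => /eqP.
pose v : 'rV[k]_3 := \row_i (q * p i)`_N.
case: (boolP [exists j, (q * p j)`_N != 0]) => [/existsP [j vj]|].
  (* The equations with second index [j] write [x] as [a] plus a multiple of [v]; the [j]-th
     coordinate of [a] is zero. *)
  pose a : 'rV[k]_3 := \row_i ((m i j)`_N / (q * p j)`_N).
  exists (fun x => exists u, x = a + u *: v).
  split.
    exists a, v; split=> //.
    by apply: contraNneq vj => /rowP /(_ j); rewrite !mxE => ->.
  move=> x /S_pt [//|hx] _; exists (x ord0 j / (q * p j)`_N).
  by apply/rowP => i; rewrite !mxE -hx; field.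
rewrite negb_exists => /forallP v0.
have {}v0 i : (q * p i)`_N = 0 by apply/eqP; rewrite -[_ == _]negbK.
(* When [v = 0], the choice of [N] gives some [m i j] a nonzero coefficient, so the equations at
   [oo] are inconsistent. No point is missing and any line will do. *)
exists (fun x => exists u, x = 0 + u *: const_mx 1); split.
  exists 0, (const_mx 1); split=> //.
  by apply/eqP => /rowP /(_ ord0); rewrite !mxE => /eqP; rewrite oner_eq0.
move=> x /S_pt [//|hx] _; case: o wN => [i|[i j]] /=; rewrite ?v0 ?eqxx //.
by rewrite -hx !v0 !mulr0 subrr eqxx.
Qed.

Theorem corollary2p9 (k : closedFieldType) (char0 : [pchar k] =i pred0)
    (S : 'rV[k]_3 -> Prop) (hS : rational_ruled_surface S) :
  exists (r p : 'I_3 -> {poly k}) (q : {poly k}),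
    standardized_parametrization S r p q /\
    (exists L : 'rV[k]_3 -> Prop, is_line L /\
       (forall x, S x -> ~ ruled_image r p q x -> L x)).
Proof.
have [[Scl _ [chain _]] [alpha [beta [gamma [gamma0 dom]]]]] := hS.
have beta0 : exists i, beta i != 0.
  apply/existsP; apply: contraT; rewrite negb_exists => /forallP b0.
  exfalso; apply: (@curve_closure_dim k 3 S alpha gamma gamma0 _ chain) => x.
  move=> /(proj2 dom) clx C Ccl hC; apply: clx => // y [s [t [gs ->]]].
  apply: hC; exists s; split=> //; apply/rowP => i; rewrite !mxE.
  by have /negPn/eqP -> := b0 i; rewrite horner0 mulr0 addr0.
have [alpha1 [beta1 [gamma1 [gamma1_0 beta1_0 szb dom1]]]] :=
  equal_degree_directions Scl gamma0 beta0 dom.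
have [g [r [p [q [[g0 betaE] q0 p_unim coprime dom2]]]]] :=
  coprime_pluecker_parametrization Scl gamma1_0 beta1_0 dom1.
exists r, p, q; split; last exact: missing_points_in_line (proj2 dom2).
split=> //.
- have [i pi0] := p_unim 0; exists i.
  by apply: contraNneq pi0 => ->; rewrite horner0.
(* Division by the common factor [g] lowers all degrees equally. *)
- move=> i j pi0 pj0; have := szb i j.
  rewrite !betaE !mulf_neq0 // !size_mul // => /(_ isT isT).
  move: (pi0) (pj0); rewrite -!size_poly_gt0; case: (size (p i)) => // a _.
  by case: (size (p j)) => // b _; rewrite !addnS => /addnI ->.
- move=> [s hs]; have [i pis] := p_unim s.
  have /hs : p i != 0 by apply: contraNneq pis => ->; rewrite horner0.
  by rewrite rootE (negbTE pis).
Qed.
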